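(* Let $\mathcal V\subseteq\mathcal U$ be open and let $Y\in \mathbf{sym}_X(\mathcal V)$ be a vertical infinitesimal symmetry of $X$ defined on $\mathcal V\times\mathbb C^n$. Expand $Y$ in its Maclaurin series with respect to $y_1,\ldots,y_n$ and group the terms by degree in $y$: $Y=Y_0+Y_1+Y_2+\cdots$, where $Y_j$ is a homogeneous polynomial vertical vector field of degree $j$ on $\mathcal V\times\mathbb C^n$. Then every homogeneous component $Y_j$ is a symmetry of $X$, i.e. $Y_j\in\mathbf{sym}_X(\mathcal V)$ for all $j\ge 0$.
   Context: Let $\mathcal U$ be a nonempty connected open subset of $\mathbb{CP}_1$ with affine coordinate $x$. A function field $\mathcal K$ is a subfield of the field of meromorphic functions on $\mathcal U$ that contains the constants $\mathbb C$ and is closed under $\frac{d}{dx}$; fix one. Fix $n\ge 1$ and $A(x)=(a_{ij}(x))\in\mathfrak{gl}(n,\mathcal K)$, and consider the linear system $\frac{dy}{dx}=A(x)y$, $y=(y_1,\ldots,y_n)$, with associated meromorphic vector field on $\mathcal U\times\mathbb C^n$ $$X=\frac{\partial}{\partial x}+\sum_{i,j=1}^n a_{ij}(x)y_j\frac{\partial}{\partial y_i}.$$ For $\mathcal V\subseteq\mathcal U$ open, $\mathbf{sym}_X(\mathcal V)$ is the set of analytic vector fields $Y$ on $\mathcal V\times\mathbb C^n$ with $[Y,X]=0$ and $Yx=0$ (vertical infinitesimal symmetries, called symmetries of $X$). Such a $Y$ has the form $Y=\sum_{i=1}^n f_i(x,y)\frac{\partial}{\partial y_i}$; its Maclaurin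 series is $Y=\sum_{i=1}^n\sum_{\alpha\in\mathbb Z_{\ge 0}^n} g_{i,\alpha}(x)y^\alpha\frac{\partial}{\partial y_i}$ with $g_{i,\alpha}$ analytic on $\mathcal V$. A homogeneous polynomial vertical vector field of degree $r$ is a vector field $\sum_i P_i(x,y)\frac{\partial}{\partial y_i}$ whose components $P_i$ are homogeneous polynomials of degree $r$ in $y_1,\ldots,y_n$. *)

(* Defs.v *)
From HB Require Import structures.
From mathcomp Require Export all_boot all_order all_algebra.
From mathcomp Require Export all_classical all_reals all_analysis.
From mathcomp Require Export complex.
From mathcomp.analysis.showcase Require Export summability.

Export numFieldNormedType.Exports.
Export Order.TTheory GRing.Theory Num.Theory.

Set Implicit Arguments.
Unset Strict Implicit.
Unset Printing Implicit Defensive.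

#[global] Open Scope classical_set_scope.
#[global] Open Scope ring_scope.

(* The usual metric topology on the complex numbers R[i]; the library only    *)
(* declares these structures on the alias R[i]^o.                             *)
HB.instance Definition _ (R : realType) := GRing.ComAlgebra.copy R[i] R[i]^o.
HB.instance Definition _ (R : realType) :=
  PseudoPointedMetric.copy R[i] R[i]^o.
HB.instance Definition _ (R : realType) := NormedModule.copy R[i] R[i]^o.

(* CP_1 as the Riemann sphere: Some x is the point of affine coordinate x and *)
(* None is the point at infinity.                                             *)
Definition CP1 (R : realType) : topologicalType :=
  one_point_compactification R[i].

Section Analytic.
Context {R : realType}.
Local Notation C := R[i].

(* Local holomorphic coordinate t centred at p: t = x - a at p = Some a, and  *)
(* t = 1/x at infinity.                                                       *)
Definition chart (p : CP1 R) (t : C) : CP1 R :=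
  match p with
  | Some a => Some (a + t)
  | None => if t == 0 then None else Some t^-1
  end.

Definition monomial (m : nat) (w : 'cV[C]_m) (alpha : 'I_m -> nat) : C :=
  \prod_(i < m) w i 0 ^+ alpha i.

(* f is, near z0, the sum of a power series in the m coordinates of z - z0.   *)
(* Convergence is along the net of finite sets of multi-indices, which over C *)
(* is the same as absolute convergence.                                       *)
Definition analytic_at (m : nat) (f : 'cV[C]_m -> C) (z0 : 'cV[C]_m) : Prop :=
  exists c : {ffun 'I_m -> nat} -> C,
    \forall z \near z0,
      partial_sum (fun alpha => c alpha * monomial (z - z0) alpha) J
      @[J --> totally] --> f z.

Definition analytic1_at (h : C -> C) (t0 : C) : Prop :=
  analytic_at (fun z : 'cV[C]_1 => h (z 0 0)) (const_mx t0).

Definition meromorphic_at (f : CP1 R -> C) (p : CP1 R) : Prop :=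
  exists (k : nat) (h : C -> C),
    analytic1_at h 0 /\ \forall t \near 0^', f (chart p t) = h t / t ^+ k.

(* A meromorphic function on U is represented by any total function CP1 -> C  *)
(* that is meromorphic at every point of U; its values at poles are junk, and *)
(* meq U is equality of the represented meromorphic functions.                *)
Definition meromorphic (U : set (CP1 R)) (f : CP1 R -> C) : Prop :=
  forall p, U p -> meromorphic_at f p.

Definition meq (U : set (CP1 R)) (f g : CP1 R -> C) : Prop :=
  forall p, U p -> \forall q \near p^', f q = g q.

(* d/dx in the affine coordinate. The value at infinity is junk: it does not  *)
(* affect the represented meromorphic function.                               *)
Definition ddx (f : CP1 R -> C) (p : CP1 R) : C :=
  if p is Some x then 'D_1 (fun s : C => f (Some s)) x else 0.

(* A set of representatives, saturated under meq, so that it is the same      *)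
(* thing as a subset of the field of meromorphic functions on U.              *)
Record function_field (U : set (CP1 R)) (K : set (CP1 R -> C)) : Prop := {
  ff_mero : forall f, K f -> meromorphic U f;
  ff_meq : forall f g, K f -> meromorphic U g -> meq U f g -> K g;
  ff_const : forall c : C, K (fun _ => c);
  ff_add : forall f g, K f -> K g -> K (fun p => f p + g p);
  ff_opp : forall f, K f -> K (fun p => - f p);
  ff_mul : forall f g, K f -> K g -> K (fun p => f p * g p);
  ff_inv : forall f, K f -> ~ meq U f (fun _ => 0) -> K (fun p => (f p)^-1);
  ff_ddx : forall f, K f -> K (ddx f)
}.

End Analytic.

Section VectorFields.
Context {R : realType} (n : nat).
Local Notation C := R[i].

(* A vector field v d/dx + \sum_i w_i d/dy_i on (part of) CP1 x C^n, given by *)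
(* its components (v, w) in the affine coordinates (x, y).                    *)
Definition vfield := CP1 R -> 'cV[C]_n -> C * 'cV[C]_n.

Definition vertical (f : CP1 R -> 'cV[C]_n -> 'cV[C]_n) : vfield :=
  fun p y => (0, f p y).

(* d/dx + \sum_(i, j) a_ij y_j d/dy_i *)
Definition linear_vfield (A : 'M[CP1 R -> C]_n) : vfield :=
  fun p y => (1, \col_i \sum_(j < n) A i j p * y j 0).

Definition apply_vfield (Z : vfield) (phi : CP1 R -> 'cV[C]_n -> C)
    (p : CP1 R) (y : 'cV[C]_n) : C :=
  (Z p y).1 * ddx (phi^~ y) p +
  \sum_(i < n) (Z p y).2 i 0 * 'D_(delta_mx i 0) (phi p) y.

Definition lie_bracket (Z W : vfield) : vfield := fun p y =>
  (apply_vfield Z (fun q u => (W q u).1) p y -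
     apply_vfield W (fun q u => (Z q u).1) p y,
   \col_i (apply_vfield Z (fun q u => (W q u).2 i 0) p y -
           apply_vfield W (fun q u => (Z q u).2 i 0) p y)).

(* f : CP1 x C^n -> C is analytic at (p, y), in the coordinates (t, y).       *)
Definition analytic_xy_at (f : CP1 R -> 'cV[C]_n -> C)
    (p : CP1 R) (y : 'cV[C]_n) : Prop :=
  analytic_at
    (fun z : 'cV[C]_(1 + n) => f (chart p (usubmx z 0 0)) (dsubmx z))
    (col_mx 0 y).

(* Vertical symmetries sum_i f_i d/dy_i, on V x C^n, of the linear field of   *)
(* matrix A. The bracket is a meromorphic vector field; it vanishes when its  *)
(* affine components vanish away from the poles of A.                         *)
Record sym (A : 'M[CP1 R -> C]_n) (V : set (CP1 R))
    (f : CP1 R -> 'cV[C]_n -> 'cV[C]_n) : Prop := {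
  sym_analytic : forall p y i, V p -> analytic_xy_at (fun q u => f q u i 0) p y;
  sym_bracket : forall x y, V (Some x) ->
    (forall i j, analytic1_at (fun s => A i j (Some s)) x) ->
    lie_bracket (vertical f) (linear_vfield A) (Some x) y = (0, 0)
}.

Definition mpartial (alpha : 'I_n -> nat) (phi : 'cV[C]_n -> C)
    : 'cV[C]_n -> C :=
  foldr (fun i psi => iter (alpha i) (fun h => 'D_(delta_mx i 0) h) psi)
    phi (enum 'I_n).

(* g_{i, alpha} = (1 / alpha!) d^alpha f_i / dy^alpha at y = 0.               *)
Definition maclaurin_coef (f : CP1 R -> 'cV[C]_n -> 'cV[C]_n)
    (i : 'I_n) (alpha : 'I_n -> nat) (p : CP1 R) : C :=
  mpartial alpha (fun u => f p u i 0) 0 / (\prod_(k < n) (alpha k)`!)%:R.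

(* Y_j; the bound alpha k <= j only makes the set of multi-indices finite.    *)
Definition homogeneous_part (f : CP1 R -> 'cV[C]_n -> 'cV[C]_n) (j : nat)
    : CP1 R -> 'cV[C]_n -> 'cV[C]_n := fun p y =>
  \col_i \sum_(alpha : {ffun 'I_n -> 'I_j.+1} |
               (\sum_(k < n) (alpha k : nat))%N == j)
    maclaurin_coef f i (fun k => alpha k) p * monomial y (fun k => alpha k).

End VectorFields.

(* Main.v *)
Require Import Defs.
From mathcomp Require Import finmap ring.

Set Implicit Arguments.
Unset Strict Implicit.
Unset Printing Implicit Defensive.

(** Near the point (p, 0), in a local coordinate s of the sphere centered at p,
    the components of Y are sums of power series in the n + 1 variables (s, y).
    Keeping only the coefficients whose degree in y is j gives the power series
    of the homogeneous component Y_j.  The bracket with X acts on power series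
    without mixing the degrees in y: d/dx and the multiplications by the a_ij
    do not touch y, and each y_l d/dy_k lowers the degree by one and raises it
    again.  So the bracket of Y_j is the part of degree j of the bracket of Y,
    which vanishes.

    The bracket at (x, y) involves the matrix A only through its value at x, so
    it is enough to work with a constant matrix and on the fiber s = 0, where a
    power series vanishes for all y if and only if its coefficients at the
    monomials free of s are zero (coef_eq0_of_eq0_on_fiber and
    eq0_on_fiber_of_coef_eq0).

    This rests on the theory of unconditionally convergent power series in
    several complex variables on a polydisc, and mostly on term-by-term
    differentiation (has_pseries_derive).  Uniqueness of the coefficients
    (has_pseries_eq0) follows from it.  It also shows that the Maclaurin
    coefficients of Y in y are analytic in s, with the expected power series
    (has_pseries_maclaurin); as Y_j is a finite sum of these coefficients times
    monomials in y, its power series is obtained with no summation by packets.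

    Polydiscs have one radius for each variable because Y_j is a polynomial in
    y: its series converges for all y as soon as s is small, so the bracket of
    Y_j can be computed from it at every y. *)

(** * Unconditional sums of complex families *)

#[local] Existing Instance totally_filter.

Section Sums.
Context {R : realType}.
Local Notation C := R[i].
Context {I : choiceType}.
Implicit Types (u v : I -> C) (J : {fset I}) (l : C).

Definition sums_to u l := partial_sum u J @[J --> totally] --> l.

Lemma partial_sumE u J : partial_sum u J = \sum_(i <- J) u i.
Proof. by rewrite /partial_sum big_seq_fsetE. Qed.

Lemma sums_toP u l : sums_to u l <->
  forall e : C, 0 < e -> exists J0, forall J, (J0 `<=` J)%fset ->
    `|l - \sum_(i <- J) u i| <= e.
Proof.
split=> [/cvgrPdist_le ul e e0 | ul].
  by have [J0 _ J0P] := ul e e0; exists J0 => J /J0P /=; rewrite partial_sumE.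
apply/cvgrPdist_le => e e0; have [J0 J0P] := ul e e0.
by exists J0 => // J /J0P; rewrite /= partial_sumE.
Qed.

Lemma sums_to_unique u l l' : sums_to u l -> sums_to u l' -> l = l'.
Proof. exact: cvg_unique. Qed.

Lemma sums_toD u v l l' :
  sums_to u l -> sums_to v l' -> sums_to (fun i => u i + v i) (l + l').
Proof.
move=> ul vl; rewrite /sums_to.
have -> : partial_sum (fun i => u i + v i) = partial_sum u \+ partial_sum v.
  by apply/funext => J; rewrite /= !partial_sumE big_split.
exact: cvgD.
Qed.

Lemma sums_toZ k u l : sums_to u l -> sums_to (fun i => k * u i) (k * l).
Proof.
move=> ul; rewrite /sums_to.
have -> : partial_sum (fun i => k * u i) = k \*: partial_sum u.
  by apply/funext => J; rewrite /= !partial_sumE -mulr_sumr.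
exact: cvgZr.
Qed.

Lemma sums_to0 : sums_to (fun=> 0) 0.
Proof.
apply/sums_toP => e e0; exists fset0 => J _.
by rewrite big1 ?subr0 ?normr0 ?ltW.
Qed.

Lemma sums_to1 u i0 : (forall i, i != i0 -> u i = 0) -> sums_to u (u i0).
Proof.
move=> u0; apply/sums_toP => e e0; exists [fset i0]%fset => J.
rewrite fsub1set => Ji0; rewrite (big_fsetD1 i0) //= big1_fset ?addr0 ?subrr ?normr0 ?ltW//.
by move=> i; rewrite !inE => /andP[ii0 _] _; exact: u0.
Qed.

Lemma sums_to_bounded u l B :
  sums_to u l -> (forall J, `|\sum_(i <- J) u i| <= B) -> `|l| <= B.
Proof.
move=> /sums_toP ul uB; apply/ler_addgt0Pr => e e0.
have [J /(_ _ (fsubset_refl _)) lJ] := ul e e0.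
by rewrite -(subrK (\sum_(i <- J) u i) l) addrC (le_trans (ler_normD _ _))// lerD.
Qed.

(** All but finitely many terms are at most 2, being differences of two partial
    sums at distance at most 1 from the sum. *)
Lemma sums_to_terms_bounded u l : sums_to u l -> exists M, 0 <= M /\ forall i, `|u i| <= M.
Proof.
move=> /sums_toP /(_ 1 ltr01)[J0 J0P].
exists (1 + 1 + \sum_(i <- J0) `|u i|).
have s0 : 0 <= \sum_(i <- J0) `|u i| by apply: sumr_ge0.
split=> [|i]; first by rewrite !addr_ge0.
case: (boolP (i \in J0)) => [iJ|iJ].
  by rewrite (big_fsetD1 i) //= addrCA lerDl addr_ge0// ?addr_ge0 // sumr_ge0.
have -> : u i = (l - \sum_(i <- J0) u i) - (l - \sum_(i <- (i |` J0)%fset) u i).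
  by rewrite big_fsetU1 //=; ring.
rewrite (le_trans (ler_normB _ _))// -[leLHS]addr0 lerD// lerD//.
  by apply: J0P; exact: fsubset_refl.
by apply: J0P; exact: fsubsetU1.
Qed.

End Sums.

Arguments sums_toZ {R I} k {u l}.

Section Reindex.
Context {R : realType} {I K : choiceType}.
Local Notation C := R[i].
Variables (h : I -> K).
Hypothesis h_inj : injective h.

Lemma sum_imfset (v : K -> C) (J : {fset I}) :
  \sum_(k <- (h @` J)%fset) v k = \sum_(i <- J) v (h i).
Proof. by rewrite big_imfset //= => x y _ _; exact: h_inj. Qed.

Lemma preimage_fset (J : {fset K}) :
  exists J' : {fset I}, forall i, (i \in J') = (h i \in J).
Proof.
have [g gP] : exists g : K -> option I, forall k i, g k = Some i <-> h i = k.
  have : forall k, exists o : option I, forall i, o = Some i <-> h i = k.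
    move=> k; have [[i hi]|n] := pselect (exists i, h i = k).
      exists (Some i) => j; split=> [[<-]//|hj]; congr Some; apply: h_inj.
      by rewrite hi hj.
    by exists None => j; split=> // hj; exfalso; apply: n; exists j.
  by move=> /choice[g gP]; exists g.
exists (seq_fset tt (pmap g J)) => i; rewrite seq_fsetE mem_pmap.
apply/mapP/idP => [[k kJ /esym/gP ->//]|hi]; exists (h i) => //.
exact/esym/gP.
Qed.

(** A family supported on the range of an injection has the same sum as its
    pull-back; all shifts of multi-indices below go through this equivalence. *)
Lemma sums_to_reindex (v : K -> C) (l : C) :
  (forall k, (forall i, h i != k) -> v k = 0) ->
  sums_to v l <-> sums_to (v \o h) l.
Proof.
move=> v0; split=> /sums_toP vl; apply/sums_toP => e e0.
  have [J0 J0P] := vl e e0; have [J1 J1P] := preimage_fset J0.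
  exists J1 => J J1J; rewrite -sum_imfset.
  have -> : \sum_(k <- (h @` J)%fset) v k = \sum_(k <- (J0 `|` (h @` J))%fset) v k.
    apply: big_fset_incl => [|k]; first exact: fsubsetUr.
    rewrite inE => /orP[kJ0|->//] khJ; apply: v0 => i; apply/eqP => hik.
    move/negP: khJ; apply; rewrite -hik; apply: in_imfset => /=.
    by apply: (fsubsetP J1J); rewrite J1P hik.
  by apply: J0P; exact: fsubsetUl.
have [J0 J0P] := vl e e0; exists (h @` J0)%fset => J hJ.
have [J1 J1P] := preimage_fset J.
have -> : \sum_(k <- J) v k = \sum_(k <- (h @` J1)%fset) v k.
  apply/esym/big_fset_incl => [|k kJ kJ1].
    by apply/fsubsetP => _ /imfsetP[i /= iJ1 ->]; rewrite -J1P.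
  apply: v0 => i; apply/eqP => hik; move/negP: kJ1; apply.
  by rewrite -hik in_imfset //= J1P hik.
rewrite sum_imfset; apply: J0P; apply/fsubsetP => i iJ0.
by rewrite J1P; apply: (fsubsetP hJ); exact: in_imfset.
Qed.

End Reindex.

Section Dominated.
Context {R : realType} {I : choiceType}.
Local Notation C := R[i].

(** The sum is the supremum of the finite partial sums. *)
Lemma sums_to_ge0 (v : I -> R) (B : R) : (forall i, 0 <= v i) ->
  (forall J : {fset I}, \sum_(i <- J) v i <= B) ->
  exists l : C, sums_to (fun i => (v i)%:C%C) l.
Proof.
move=> v0 vB; pose E := [set x | exists J : {fset I}, x = \sum_(i <- J) v i].
have ubE x : E x -> x <= sup E.
  by apply: ub_le_sup; exists B => _ [J ->]; exact: vB.
have supE : has_sup E.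
  split; first by exists (\sum_(i <- fset0) v i), fset0.
  by exists B => _ [J ->]; exact: vB.
exists (sup E)%:C%C; apply/sums_toP => e e0.
have eE : e = (complex.Re e)%:C%C by rewrite RRe_real// gtr0_real.
have [_ [J0 ->] J0e] : exists2 x, E x & sup E - complex.Re e < x.
  by apply: sup_adherent => //; rewrite -ltcR -eE.
exists J0 => J J0J; rewrite -raddf_sum/= -raddfB/= eE ger0_norm; last first.
  by rewrite ler0c subr_ge0 ubE//; exists J.
rewrite lecR lerBlDr -lerBlDl (le_trans (ltW J0e))//.
pose w i := if i \in J0 then v i else 0.
rewrite (_ : \sum_(i <- J0) v i = \sum_(i <- J) w i).
  by apply: ler_sum => i _; rewrite /w; case: ifP.
rewrite -(big_fset_incl _ J0J) => [|i _ /negPf iJ0]; last by rewrite /w iJ0.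
by apply: eq_big_seq => i iJ0; rewrite /w iJ0.
Qed.

Lemma Im_le_normc (x : C) : `|complex.Im x|%:C%C <= `|x|.
Proof.
have := normc_ge_Re (x * 'i%C); rewrite ReiNIm normrN normrM.
by rewrite (_ : `|'i%C| = 1) ?mulr1// normc_def /= expr0n expr1n add0r sqrtr1.
Qed.

(** Completeness of the complex numbers for absolutely convergent families: if b
    dominates u, then Re u + b and Im u + b are nonnegative families with
    bounded partial sums. *)
Lemma sums_to_dominated (u b : I -> C) (B : C) : (forall i, `|u i| <= b i) ->
  (forall J : {fset I}, \sum_(i <- J) b i <= B) -> exists l : C, sums_to u l.
Proof.
move=> ub bB; pose be i := complex.Re (b i).
have bE i : b i = (be i)%:C%C by rewrite RRe_real// ger0_real// (le_trans _ (ub i)).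
have BE : B = (complex.Re B)%:C%C.
  by rewrite RRe_real// ger0_real// (le_trans _ (bB fset0))// big_seq_fset0.
have [Reu Imu] : (forall i, `|complex.Re (u i)| <= be i) /\
                 (forall i, `|complex.Im (u i)| <= be i).
  split=> i; rewrite -lecR -bE (le_trans _ (ub i))//.
    exact: normc_ge_Re.
  exact: Im_le_normc.
have beB (J : {fset I}) : \sum_(i <- J) be i <= complex.Re B.
  by rewrite -lecR -BE (le_trans _ (bB J))// raddf_sum /= (eq_bigr b).
have aux (v : I -> R) : (forall i, `|v i| <= be i) ->
    exists l : C, sums_to (fun i => (v i)%:C%C) l.
  move=> vbe.
  have [l1 L1] : exists l : C, sums_to (fun i => (v i + be i)%:C%C) l.
    apply: (sums_to_ge0 (B := complex.Re B + complex.Re B)) => [i|J].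
      by rewrite -lerBlDr sub0r; move: (vbe i); rewrite ler_norml => /andP[].
    rewrite big_split lerD// (le_trans _ (beB J))// ler_sum// => i _.
    exact: le_trans (ler_norm _) (vbe i).
  have [l2 L2] : exists l : C, sums_to (fun i => (be i)%:C%C) l.
    by apply: (sums_to_ge0 (B := complex.Re B)) => // i; apply: le_trans (vbe i).
  exists (l1 + -1 * l2); have := sums_toD L1 (sums_toZ (-1) L2).
  by congr sums_to; apply/funext => i; rewrite raddfD/= mulN1r addrK.
have [[l1 L1] [l2 L2]] := (aux _ Reu, aux _ Imu).
exists (l1 + 'i%C * l2); have := sums_toD L1 (sums_toZ 'i%C L2).
by congr sums_to; apply/funext => i; rewrite -complexE.
Qed.

End Dominated.

(** * Remainder of the first-order expansion of a power *)

Section PowerEstimates.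
Context {R : realType}.
Local Notation C := R[i].

Definition pow_rem (x h : C) (a : nat) : C :=
  (x + h) ^+ a - x ^+ a - a%:R * x ^+ a.-1 * h.

Lemma pow_remS x h a :
  pow_rem x h a.+1 = (x + h) * pow_rem x h a + a%:R * x ^+ a.-1 * h ^+ 2.
Proof.
case: a => [|a]; rewrite /pow_rem /=; first by rewrite !expr0 !expr1; ring.
by rewrite !exprS -[in LHS]natr1 -[in RHS]natr1; ring.
Qed.

(** The recursion pow_remS has nonnegative coefficients, so the remainder for
    complex x and h is dominated by the one for their norms; being divisible by
    the square of h, the latter scales at least quadratically in h. *)
Lemma pow_rem_le (x h d : C) a : `|h| <= d ->
  `|pow_rem x h a| * d ^+ 2 <= `|h| ^+ 2 * pow_rem `|x| d a.
Proof.
move=> hd; have d0 : 0 <= d by rewrite (le_trans _ hd).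
elim: a => [|a IH].
  by rewrite /pow_rem !expr0 !subrr !mul0r !subr0 normr0 mul0r mulr0.
rewrite !pow_remS (le_trans (ler_wpM2r _ (ler_normD _ _))) ?exprn_ge0//.
rewrite mulrDl [leRHS]mulrDr lerD//; last first.
  by rewrite !normrM !normrX normr_nat le_eqVlt; apply/orP; left; apply/eqP; ring.
rewrite normrM -mulrA [leRHS]mulrCA.
apply: ler_pM => //; first by rewrite mulr_ge0// exprn_ge0.
by rewrite (le_trans (ler_normD _ _))// lerD.
Qed.

Lemma pow_rem_ge0 (x d : C) a : 0 < d -> 0 <= pow_rem `|x| d a.
Proof.
move=> d0; have dd : `|d| <= d by rewrite gtr0_norm.
rewrite -(pmulr_rge0 _ (exprn_gt0 2 d0)) -{1}(gtr0_norm d0).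
by rewrite (le_trans _ (pow_rem_le x a dd))// mulr_ge0// exprn_ge0// ltW.
Qed.

(** The bound is again an a-th power, whose base is only slightly larger than the
    norm of x: a geometric series that dominates at a larger radius absorbs
    it. *)
Lemma pow_rem_bound (x h d : C) a : 0 < d -> `|h| <= d ->
  `|pow_rem x h a| <= `|h| ^+ 2 * d ^- 2 * (`|x| + d) ^+ a.
Proof.
move=> d0 hd; rewrite -mulrA [X in _ <= _ * X]mulrC mulrA ler_pdivlMr ?exprn_gt0//.
rewrite (le_trans (pow_rem_le _ _ hd))// ler_wpM2l ?exprn_ge0//.
by rewrite /pow_rem -addrA gerDl -opprD oppr_le0 addr_ge0// ?mulr_ge0// ?exprn_ge0 ?ltW.
Qed.

Lemma pow_deriv_bound (x d : C) a : 0 < d ->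
  a%:R * `|x| ^+ a.-1 <= d^-1 * (`|x| + d) ^+ a.
Proof.
move=> d0; rewrite [leRHS]mulrC ler_pdivlMr// -subr_ge0.
have := pow_rem_ge0 x a d0; rewrite /pow_rem => /le_trans; apply.
by rewrite lerB// gerBl exprn_ge0.
Qed.

End PowerEstimates.

(** * Geometric domination of power series *)

Section Geometric.
Context {R : realType}.
Local Notation C := R[i].

Lemma geometric_le (q : C) N : 0 <= q -> q < 1 -> \sum_(a < N) q ^+ a <= (1 - q)^-1.
Proof.
move=> q0 q1; have q10 : 0 < 1 - q by rewrite subr_gt0.
rewrite -[leRHS]mul1r ler_pdivlMr// mulrC -opprB mulNr -subrX1 opprB.
by rewrite gerBl exprn_ge0.
Qed.

(** A finite set of multi-indices lies in a box, and over a box the sum of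
    products is the product of the geometric sums. *)
Lemma multi_geometric_le m (q : 'I_m -> C) (J : {fset {ffun 'I_m -> nat}}) :
  (forall k, 0 <= q k) -> (forall k, q k < 1) ->
  \sum_(al <- J) \prod_k q k ^+ al k <= \prod_k (1 - q k)^-1.
Proof.
move=> q0 q1; pose N := \max_(al : J) \max_k (val al k).
have leN (al : J) k : (val al k < N.+1)%N.
  rewrite ltnS.
  apply: leq_trans (leq_bigmax (F := fun al : J => \max_l val al l) al).
  exact: (leq_bigmax (F := val al) k).
pose g (al : J) : {ffun 'I_m -> 'I_N.+1} := [ffun k => inord (val al k)].
have g_inj : injective g.
  move=> al be /ffunP gab; apply/val_inj/ffunP => k.
  by have := congr1 val (gab k); rewrite !ffunE /= (inordK (leN al k)) (inordK (leN be k)).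
rewrite big_seq_fsetE /=.
apply: (@le_trans _ _ (\sum_(b : {ffun 'I_m -> 'I_N.+1}) \prod_k q k ^+ b k)).
  rewrite (bigID (mem (g @: [set: J]%SET))) /=.
  rewrite big_imset /=; last by move=> ? ? _ _; exact: g_inj.
  rewrite -[leLHS]addr0 lerD//; last first.
    by apply: sumr_ge0 => b _; apply: prodr_ge0 => k _; rewrite exprn_ge0.
  rewrite le_eqVlt; apply/orP; left; apply/eqP; apply: eq_big => [al|al _].
    by rewrite inE.
  by apply: eq_bigr => k _; rewrite ffunE (inordK (leN al k)).
rewrite -(bigA_distr_bigA (fun k (a : 'I_N.+1) => q k ^+ a)) /=.
apply: ler_prod => k _; rewrite geometric_le// andbT.
by apply: sumr_ge0 => a _; rewrite exprn_ge0.
Qed.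

End Geometric.

(** * Power series on polydiscs *)

Notation multi_index m := {ffun 'I_m -> nat}.

Section PowerSeries.
Context {R : realType} {m : nat}.
Local Notation C := R[i].
Implicit Types (f : 'cV[C]_m -> C) (c : multi_index m -> C) (r : 'I_m -> C)
  (w z : 'cV[C]_m) (al be : multi_index m) (k : 'I_m).

Definition polydisc r : set 'cV[C]_m := [set w | forall k, `|w k 0| < r k].

Definition has_pseries f z0 c r := forall w, polydisc r w ->
  sums_to (fun al => c al * monomial w al) (f (z0 + w)).

Lemma normr_monomial w al : `|monomial w al| = \prod_k `|w k 0| ^+ al k.
Proof. by rewrite normr_prod; apply: eq_bigr => k _; rewrite normrX. Qed.

(** Cauchy estimate, read off from the convergence at the point of coordinates rho. *)
Lemma coef_bounded f z0 c r (rho : 'I_m -> C) : has_pseries f z0 c r ->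
  (forall k, 0 <= rho k < r k) ->
  exists M, 0 <= M /\ forall al, `|c al| * \prod_k rho k ^+ al k <= M.
Proof.
move=> fc rhor; pose w : 'cV[C]_m := \col_k rho k.
have wE k : `|w k 0| = rho k by rewrite mxE ger0_norm//; case/andP: (rhor k).
have /fc/sums_to_terms_bounded[M [M0 cM]] : polydisc r w.
  by move=> k; rewrite wE; case/andP: (rhor k).
exists M; split=> // al; rewrite (le_trans _ (cM al))// normrM normr_monomial.
by under [X in _ <= _ * X]eq_bigr do rewrite wE.
Qed.

(** Abel's lemma. *)
Lemma coef_dominated c (M : C) (rho v : 'I_m -> C) : 0 <= M ->
  (forall al, `|c al| * \prod_k rho k ^+ al k <= M) ->
  (forall k, 0 <= v k < rho k) -> forall J : {fset multi_index m},
  \sum_(al <- J) `|c al| * \prod_k v k ^+ al k <=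
    M * \prod_k (1 - v k / rho k)^-1.
Proof.
move=> M0 cM vrho J.
have rho0 k : 0 < rho k by case/andP: (vrho k); exact: le_lt_trans.
apply: (@le_trans _ _ (M * \sum_(al <- J) \prod_k (v k / rho k) ^+ al k)).
  rewrite mulr_sumr; apply: ler_sum => al _.
  rewrite (_ : \prod_k v k ^+ al k =
      \prod_k rho k ^+ al k * \prod_k (v k / rho k) ^+ al k).
    rewrite mulrA ler_wpM2r//; apply: prodr_ge0 => k _.
    by rewrite exprn_ge0// divr_ge0 ?(ltW (rho0 k))//; case/andP: (vrho k).
  rewrite -big_split; apply: eq_bigr => k _ /=.
  by rewrite -exprMn mulrCA divff ?mulr1 ?gt_eqF.
rewrite ler_wpM2l//; apply: multi_geometric_le => k; case/andP: (vrho k) => v0 vr.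
  by rewrite divr_ge0// ltW.
by rewrite ltr_pdivrMr// mul1r.
Qed.

Definition incr be k (a : nat) : multi_index m :=
  [ffun l => (be l + (l == k) * a)%N].

Definition deriv_coef k c be : C := (be k).+1%:R * c (incr be k 1).

(** The differentiated monomial, indexed by the exponent before differentiation;
    the index becomes its own exponent in [sums_to_deriv], where the terms that do
    not depend on the k-th variable drop out. *)
Definition dmonomial k w al : C :=
  (al k)%:R * w k 0 ^+ (al k).-1 * \prod_(l | l != k) w l 0 ^+ al l.

Lemma monomialD1 k w al :
  monomial w al = w k 0 ^+ al k * \prod_(l | l != k) w l 0 ^+ al l.
Proof. by rewrite /monomial (bigD1 k). Qed.

Lemma monomial_rem k w (h : C) al :
  monomial (w + h *: delta_mx k 0) al - monomial w al - h * dmonomial k w al =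
  pow_rem (w k 0) h (al k) * \prod_(l | l != k) w l 0 ^+ al l.
Proof.
rewrite !(monomialD1 k) /dmonomial /pow_rem !mxE !eqxx mulr1.
rewrite (eq_bigr (fun l => w l 0 ^+ al l)) => [|l /negPf lk]; first by ring.
by rewrite !mxE lk mulr0 addr0.
Qed.

Lemma dmonomial_incr k w be :
  dmonomial k w (incr be k 1) = (be k).+1%:R * monomial w be.
Proof.
rewrite /dmonomial (monomialD1 k) ffunE eqxx addn1 /= -mulrA; congr (_ * (_ * _)).
by apply: eq_bigr => l /negPf lk; rewrite ffunE lk addn0.
Qed.

Lemma incr_inj k a : injective (fun be => incr be k a).
Proof.
move=> be be' /ffunP e; apply/ffunP => l; have := e l; rewrite !ffunE.
by move/eqP; rewrite eqn_add2r => /eqP.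
Qed.

Lemma sums_to_deriv k c w (l : C) :
  sums_to (fun al => c al * dmonomial k w al) l ->
  sums_to (fun be => deriv_coef k c be * monomial w be) l.
Proof.
move=> /(sums_to_reindex (@incr_inj k 1)) H.
rewrite (_ : (fun be => _) = (fun al => c al * dmonomial k w al) \o (fun be => incr be k 1)).
  apply/H => al al_incr; case: (posnP (al k)) => [al0|al0].
    by rewrite /dmonomial al0 mul0r mul0r mulr0.
  have := al_incr [ffun l => (al l - (l == k))%N]; case/negP; apply/eqP/ffunP => j.
  by rewrite !ffunE muln1; case: eqVneq => [->|_]; rewrite ?subnK// subn0 addn0.
apply/funext => be; rewrite /= dmonomial_incr /deriv_coef; ring.
Qed.

(** The error is taken quadratic so that, for a power series, it can be estimated
    monomial by monomial and summed. *)
Lemma derive_quadratic f z (v : 'cV[C]_m) (d B l : C) : 0 < d ->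
  (forall h : C, `|h| <= d -> `|f (z + h *: v) - f z - h * l| <= B * `|h| ^+ 2) ->
  'D_v f z = l.
Proof.
move=> d0 fB; apply: cvg_lim; first exact: norm_hausdorff.
apply/cvgrPdist_le => e e0.
have B0 : 0 <= B.
  have := fB d; rewrite gtr0_norm// => /(_ (lexx _)).
  by move=> /(le_trans (normr_ge0 _)); rewrite pmulr_lge0 ?exprn_gt0.
have d'0 : 0 < e / (B + 1) by rewrite divr_gt0// ltr_wpDl.
near=> h.
have hd : `|h| < d by near: h; exact: dnbhs0_lt.
have he : `|h| < e / (B + 1) by near: h; exact: dnbhs0_lt.
have h0 : h != 0 by near: h; exact: nbhs_dnbhs_neq.
have hn0 : 0 < `|h| by rewrite normr_gt0.
rewrite -(ler_pM2l hn0) -normrM mulrBr -normrN opprB mulrA divff// mul1r.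
rewrite /= [_ + z]addrC (le_trans (fB h (ltW hd)))//.
rewrite expr2 mulrCA ler_pM2l//.
rewrite (@le_trans _ _ ((B + 1) * `|h|)) ?ler_wpM2r ?lerDl//.
by rewrite mulrC -ler_pdivlMr ?ltW// ltr_wpDl.
Unshelve. all: by end_near. Qed.

(** Around w, the k-th coordinate is allowed to vary by d while the others keep
    their norms; the resulting radii v are still smaller than radii rho inside
    the polydisc, at which the coefficients are bounded.  Hence, on one
    dominating geometric series, the differentiated series converges and the
    remainders of all monomials add up to a quadratic error. *)
Lemma has_pseries_derive f z0 c r k : has_pseries f z0 c r ->
  has_pseries ('D_(delta_mx k 0) f) z0 (deriv_coef k c) r.
Proof.
move=> fc w wr.
pose rho l := (`|w l 0| + r l) / 2.
have wrho l : `|w l 0| < rho l < r l by rewrite !midf_lt.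
pose d := (rho k - `|w k 0|) / 2.
have d0 : 0 < d by rewrite divr_gt0// subr_gt0; case/andP: (wrho k).
have wd : `|w k 0| + d < rho k.
  have /andP[/midf_lt[_ +] _] := wrho k; apply: le_lt_trans.
  by rewrite /d le_eqVlt; apply/orP; left; apply/eqP; field.
pose v l := if l == k then `|w k 0| + d else `|w l 0|.
have v0 l : 0 <= v l by rewrite /v; case: ifP => // _; rewrite addr_ge0// ltW.
have vrho l : 0 <= v l < rho l.
  by rewrite v0 /v; case: eqVneq => [->//|_]; case/andP: (wrho l).
have [M [M0 cM]] : exists M, 0 <= M /\ forall al, `|c al| * \prod_l rho l ^+ al l <= M.
  apply: coef_bounded fc _ => l; case/andP: (wrho l) => wl ->.
  by rewrite (le_trans _ (ltW wl)).
have cB := coef_dominated M0 cM vrho; set B := M * _ in cB.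
have prodv al : \prod_l v l ^+ al l =
    (`|w k 0| + d) ^+ al k * `|\prod_(l | l != k) w l 0 ^+ al l|.
  rewrite (bigD1 k)//= {1}/v eqxx normr_prod; congr (_ * _).
  by apply: eq_bigr => l /negPf lk; rewrite /v lk normrX.
have [l Hl] : exists l, sums_to (fun al => c al * dmonomial k w al) l.
  apply: (@sums_to_dominated _ _ _
    (fun al => d^-1 * (`|c al| * \prod_l v l ^+ al l)) (d^-1 * B)) => [al|J].
    rewrite prodv !normrM normr_nat normrX [leRHS]mulrCA ler_wpM2l// [leRHS]mulrA ler_wpM2r//.
    exact: pow_deriv_bound.
  by rewrite -mulr_sumr ler_wpM2l// invr_ge0 ltW.
suff -> : 'D_(delta_mx k 0) f (z0 + w) = l by exact: sums_to_deriv.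
apply: (@derive_quadratic _ _ _ d (d ^- 2 * B)) => // h hd.
have wh : polydisc r (w + h *: delta_mx k 0).
  move=> j; case/andP: (vrho j) => _ /lt_trans; case/andP: (wrho j) => _ /[swap] /[apply].
  apply: le_lt_trans; rewrite !mxE /v eqxx andbT; case: eqVneq => [->|_].
    by rewrite mulr1 (le_trans (ler_normD _ _))// lerD.
  by rewrite mulr0 addr0.
have := sums_toD (sums_toD (fc _ wh) (sums_toZ (-1) (fc _ wr))) (sums_toZ (- h) Hl).
rewrite mulN1r mulNr addrA => /sums_to_bounded; apply=> J.
rewrite mulrC mulrA (le_trans (ler_norm_sum _ _ _))//.
apply: (@le_trans _ _ (\sum_(al <- J)
    `|h| ^+ 2 * d ^- 2 * (`|c al| * \prod_l v l ^+ al l))); last first.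
  by rewrite -mulr_sumr ler_wpM2l// mulr_ge0// ?invr_ge0 exprn_ge0// ltW.
apply: ler_sum => al _.
rewrite (_ : _ + _ = c al * (monomial (w + h *: delta_mx k 0) al -
  monomial w al - h * dmonomial k w al)); last by ring.
rewrite monomial_rem prodv !normrM [leRHS]mulrCA ler_wpM2l// [leRHS]mulrA ler_wpM2r//.
exact: pow_rem_bound.
Qed.

End PowerSeries.

(** * Operations on power series and uniqueness of coefficients *)

Section PowerSeriesOps.
Context {R : realType} {m : nat}.
Local Notation C := R[i].
Implicit Types (f g : 'cV[C]_m -> C) (c d : multi_index m -> C) (r : 'I_m -> C)
  (w z : 'cV[C]_m) (al be : multi_index m) (k : 'I_m).

Lemma eq_has_pseries f g z0 c d r :
  has_pseries f z0 c r ->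
  (forall w, polydisc r w -> f (z0 + w) = g (z0 + w)) -> c =1 d ->
  has_pseries g z0 d r.
Proof. by move=> fc fg /funext <- w wr; rewrite -fg//; exact: fc. Qed.

Lemma has_pseries0 z0 r : has_pseries (fun=> 0) z0 (fun=> 0) r.
Proof.
move=> w _; rewrite (_ : (fun al => _) = fun=> 0); first exact: sums_to0.
by apply/funext => al; rewrite mul0r.
Qed.

Lemma has_pseriesD f g z0 c d r : has_pseries f z0 c r -> has_pseries g z0 d r ->
  has_pseries (fun z => f z + g z) z0 (fun al => c al + d al) r.
Proof.
move=> fc gd w wr; have := sums_toD (fc w wr) (gd w wr).
by congr sums_to; apply/funext => al; rewrite mulrDl.
Qed.

Lemma has_pseriesZ a f z0 c r : has_pseries f z0 c r ->
  has_pseries (fun z => a * f z) z0 (fun al => a * c al) r.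
Proof.
move=> fc w wr; have := sums_toZ a (fc w wr).
by congr sums_to; apply/funext => al; rewrite mulrA.
Qed.

Lemma has_pseries_sum (I : Type) (s : seq I) (P : pred I) (F : I -> 'cV[C]_m -> C)
    z0 (c : I -> multi_index m -> C) r :
  (forall i, P i -> has_pseries (F i) z0 (c i) r) ->
  has_pseries (fun z => \sum_(i <- s | P i) F i z) z0
    (fun al => \sum_(i <- s | P i) c i al) r.
Proof.
move=> Fc; elim: s => [|i s IH].
  by refine (eq_has_pseries (@has_pseries0 z0 r) _ _) => [w _|al]; rewrite big_nil.
have [Pi|nPi] := boolP (P i).
  by refine (eq_has_pseries (has_pseriesD (Fc i Pi) IH) _ _) => [w _|al]; rewrite big_cons Pi.
by refine (eq_has_pseries IH _ _) => [w _|al]; rewrite big_cons (negPf nPi).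
Qed.

(** Coefficients of the product of the monomial of exponent al with the series c. *)
Definition mono_coef al c be : C :=
  if [forall k, al k <= be k]%N then c [ffun k => (be k - al k)%N] else 0.

Lemma has_pseries_mono al f z0 c r : has_pseries f z0 c r ->
  has_pseries (fun z => monomial (z - z0) al * f z) z0 (mono_coef al c) r.
Proof.
move=> fc w wr; rewrite [z0 + w]addrC addrK -[w + z0]addrC.
pose h be : multi_index m := [ffun k => (be k + al k)%N].
have h_inj : injective h.
  move=> be be' /ffunP e; apply/ffunP => k; have := e k; rewrite !ffunE.
  by move/eqP; rewrite eqn_add2r => /eqP.
apply/(sums_to_reindex h_inj) => [ga al_ga|].
  rewrite /mono_coef; case: ifP => [/forallP alga|_]; last by rewrite mul0r.
  have := al_ga [ffun k => (ga k - al k)%N]; case/negP; apply/eqP/ffunP => k.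
  by rewrite !ffunE subnK.
have := sums_toZ (monomial w al) (fc w wr); congr sums_to; apply/funext => be /=.
rewrite /mono_coef ifT; last by apply/forallP => k; rewrite ffunE leq_addl.
rewrite (_ : [ffun k => _] = be); last by apply/ffunP => k; rewrite !ffunE addnK.
rewrite mulrCA; congr (_ * _); rewrite /monomial -big_split.
by apply: eq_bigr => k _; rewrite ffunE exprD mulrC.
Qed.

(** The coordinate is not centered at z0, so that the coefficients are a shift of
    c plus a multiple of c; only their existence is used. *)
Lemma has_pseries_coord k f z0 c r : has_pseries f z0 c r ->
  exists d, has_pseries (fun z => z k 0 * f z) z0 d r.
Proof.
move=> fc.
have := has_pseriesD (has_pseriesZ (a := z0 k 0) fc)
  (has_pseries_mono (al := [ffun l => nat_of_bool (l == k)]) fc).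
move=> H; eexists; refine (eq_has_pseries H _ _) => [w _|//].
rewrite [z0 + w]addrC addrK /monomial (bigD1 k)//= ffunE eqxx expr1 big1 => [|l /negPf lk].
  by rewrite mulr1 !mxE; ring.
by rewrite ffunE lk expr0.
Qed.

Lemma has_pseries_sub f z0 c r r' : (forall k, r' k <= r k) ->
  has_pseries f z0 c r -> has_pseries f z0 c r'.
Proof. by move=> r'r fc w wr'; apply: fc => k; exact: lt_le_trans (wr' k) (r'r k). Qed.

Lemma multi_index_neq0 al : al != [ffun=> 0%N] -> exists k, al k != 0%N.
Proof.
move=> al0; apply/existsP; apply: contraNT al0 => /existsPn a.
by apply/eqP/ffunP => k; rewrite ffunE; apply/eqP; rewrite -[_ == _]negbK a.
Qed.

Lemma monomial0 al : monomial (0 : 'cV[C]_m) al = (al == [ffun=> 0%N])%:R.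
Proof.
case: eqVneq => [->|al0].
  by rewrite /monomial big1// => k _; rewrite ffunE expr0.
have [k alk] := multi_index_neq0 al0.
by rewrite (monomialD1 k) mxE expr0n (negPf alk) mul0r.
Qed.

Lemma has_pseries_center f z0 c r : (forall k, 0 < r k) -> has_pseries f z0 c r ->
  f z0 = c [ffun=> 0%N].
Proof.
move=> r0 fc; have /fc : polydisc r 0 by move=> k; rewrite mxE normr0.
rewrite addr0 => fz; apply: sums_to_unique fz _.
have := @sums_to1 R _ (fun al => c al * monomial (0 : 'cV_m) al) [ffun=> 0%N].
rewrite monomial0 eqxx mulr1; apply => al al0.
by rewrite monomial0 (negPf al0) mulr0.
Qed.

(** By induction on the size of al: the constant coefficient is the value at the
    center, and any other one is, up to a nonzero factor, a smaller coefficient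
    of a partial derivative, whose sum vanishes too. *)
Lemma has_pseries_eq0 f z0 c r : (forall k, 0 < r k) -> has_pseries f z0 c r ->
  (forall w, polydisc r w -> f (z0 + w) = 0) -> forall al, c al = 0.
Proof.
move=> r0 fc f0 al.
have {fc f0} : has_pseries (fun=> 0) z0 c r by exact: (eq_has_pseries fc).
have [N] := ubnP (\sum_k al k)%N; elim: N => // N IH in al c * => alN fc.
have [->|al0] := eqVneq al [ffun=> 0%N]; first exact/esym/(has_pseries_center r0 fc).
have [k alk] := multi_index_neq0 al0.
pose be : multi_index m := [ffun l => (al l - (l == k))%N].
have albe : al = incr be k 1.
  apply/ffunP => l; rewrite !ffunE muln1; case: eqVneq => [->|_].
    by rewrite subnK// lt0n.
  by rewrite subn0 addn0.
have beN : (\sum_l be l < N)%N.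
  rewrite -ltnS (leq_trans _ alN)// ltnS (bigD1 k)//= [in leqRHS](bigD1 k)//=.
  rewrite -addSn leq_add//; first by rewrite ffunE eqxx subn1 prednK// lt0n.
  by apply: leq_sum => l _; rewrite ffunE leq_subr.
have : deriv_coef k c be = 0.
  apply: IH beN _.
  refine (eq_has_pseries (has_pseries_derive (k := k) fc) _ _) => // w _.
  exact: derive_cst.
by rewrite /deriv_coef -albe => /eqP; rewrite mulf_eq0 pnatr_eq0 => /eqP.
Qed.

Lemma has_pseries_near f z0 c r : (forall k, 0 < r k) -> has_pseries f z0 c r ->
  \forall z \near z0,
    partial_sum (fun al => c al * monomial (z - z0) al) J @[J --> totally] --> f z.
Proof.
move=> r0 fc.
have H : forall k, \forall z \near z0, `|z0 k 0 - (z : 'cV[C]_m) k 0| < r k.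
  move=> k; have := @coord_continuous _ m 1 k 0 z0.
  by move=> /cvgrPdist_lt /(_ (r k) (r0 k)).
refine (filterS _ (filter_forall _ H)) => z zr.
have /fc : polydisc r (z - z0) by move=> k; rewrite !mxE distrC.
by rewrite subrKC.
Qed.

Lemma near_has_pseries f z0 c :
  (\forall z \near z0,
    partial_sum (fun al => c al * monomial (z - z0) al) J @[J --> totally] --> f z) ->
  exists2 e : C, 0 < e & has_pseries f z0 c (fun=> e).
Proof.
move=> /nbhs_ballP[e /= e0 fc]; exists e => // w we.
have := fc (z0 + w); rewrite [z0 + w]addrC addrK => H; rewrite /sums_to; apply: H.
split=> // i j; rewrite (ord1 j) /ball /= !mxE opprD addrCA subrr addr0 normrN.
exact: we.
Qed.

End PowerSeriesOps.

(** * Iterated derivatives along the fibers *)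

Section Slices.
Context {R : realType} {n : nat}.
Local Notation C := R[i].
Local Notation ix := (lshift n (ord0 : 'I_1)).
Local Notation iy := (@rshift 1 n).
Implicit Types (G : 'cV[C]_(1 + n) -> C) (c : multi_index (1 + n) -> C)
  (be : multi_index (1 + n)) (s : seq 'I_n) (k : 'I_n) (al : 'I_n -> nat).

(** Both derivatives are limits of the same difference quotients. *)
Lemma derive_slice G (t : 'cV[C]_1) (y : 'cV[C]_n) k :
  'D_(delta_mx k 0) (fun u => G (col_mx t u)) y =
  'D_(delta_mx (iy k) 0) G (col_mx t y).
Proof.
rewrite /derive; set g := fun h => _; set g' := fun h => _.
suff -> : g = g' by [].
apply/funext => h; rewrite /g /g' /=; congr (_ *: (G _ - _)).
by rewrite -[delta_mx (iy k) 0]vsubmxK scale_col_mx add_col_mx; congr col_mx;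
   apply/colP => l; rewrite !mxE ?eq_rshift ?eq_lrshift ?mulr0 ?add0r.
Qed.

Definition derive_y s al G : 'cV[C]_(1 + n) -> C :=
  foldr (fun k psi => iter (al k) (fun h => 'D_(delta_mx (iy k) 0) h) psi) G s.

Definition deriv_y_coef s al c : multi_index (1 + n) -> C :=
  foldr (fun k d => iter (al k) (deriv_coef (iy k)) d) c s.

Lemma mpartial_slice al G (t : 'cV[C]_1) (y : 'cV[C]_n) :
  mpartial al (fun u => G (col_mx t u)) y = derive_y (enum 'I_n) al G (col_mx t y).
Proof.
suff -> : mpartial al (fun u => G (col_mx t u)) =
    fun u => derive_y (enum 'I_n) al G (col_mx t u) by [].
have step k a (H : 'cV[C]_(1 + n) -> C) :
    iter a (fun h => 'D_(delta_mx k 0) h) (fun u => H (col_mx t u)) =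
    fun u => iter a (fun h => 'D_(delta_mx (iy k) 0) h) H (col_mx t u).
  elim: a => [//|a IH]; rewrite iterS IH iterS.
  by apply/funext => u; exact: derive_slice.
rewrite /mpartial /derive_y; elim: (enum _) => [//|k s IH].
by rewrite /= IH step.
Qed.

Lemma has_pseries_derive_y s al G z0 c r : has_pseries G z0 c r ->
  has_pseries (derive_y s al G) z0 (deriv_y_coef s al c) r.
Proof.
move=> Gc; elim: s => [|k s IH] /=; first exact: Gc.
elim: (al k) => [|a IHa] /=; first exact: IH.
exact: has_pseries_derive.
Qed.

Lemma iter_deriv_coef (l : 'I_(1 + n)) a c be :
  iter a (deriv_coef l) c be = ((be l + a) ^_ a)%:R * c (incr be l a).
Proof.
elim: a c => [|a IH] c.
  rewrite /= ffactn0 mul1r; congr c; apply/ffunP => j.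
  by rewrite ffunE muln0 addn0.
rewrite iterSr IH /deriv_coef mulrA -natrM ffunE eqxx mul1n addnS ffactnS /= mulnC.
congr (_ * c _); apply/ffunP => j; rewrite !ffunE.
by rewrite -addnA -mulnDr addn1.
Qed.

Definition raise_y s al be : multi_index (1 + n) :=
  [ffun l => (be l + \sum_(k <- s) (l == iy k) * al k)%N].

(** When the exponents of the y-variables of be vanish, the successive falling
    factorials are factorials, the ones that the Maclaurin coefficients divide
    by. *)
Lemma deriv_y_coefE s al c be : uniq s -> (forall k, k \in s -> be (iy k) = 0%N) ->
  deriv_y_coef s al c be = (\prod_(k <- s) (al k)`!)%:R * c (raise_y s al be).
Proof.
elim: s be => [|k s IH] be /=.
  move=> _ _; rewrite big_nil mul1r; congr c; apply/ffunP => l.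
  by rewrite ffunE big_nil addn0.
move=> /andP[ks us] be0; rewrite iter_deriv_coef be0 ?mem_head// add0n ffactnn.
rewrite IH//; last first.
  move=> k' k's; rewrite ffunE be0 ?in_cons ?k's ?orbT// eq_rshift.
  by case: eqVneq k's ks => // -> ->.
rewrite big_cons natrM mulrA; congr (_ * c _); apply/ffunP => l.
by rewrite !ffunE big_cons addnA.
Qed.

Definition lift_y al : multi_index (1 + n) :=
  [ffun l => if fintype.split l is inr k then al k else 0%N].

Lemma lift_yx al : lift_y al ix = 0%N.
Proof. by rewrite ffunE (unsplitK (inl _)). Qed.

Lemma lift_yy al k : lift_y al (iy k) = al k.
Proof. by rewrite ffunE (unsplitK (inr _)). Qed.

Lemma index_xyP (P : 'I_(1 + n) -> Prop) : P ix -> (forall k, P (iy k)) -> forall l, P l.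
Proof.
by move=> Px Py l; case: (split_ordP l)=> [j|k] ->//; rewrite (ord1 j).
Qed.

End Slices.

(** * Power series of the homogeneous components *)

Section Homogeneous.
Context {R : realType} {n : nat}.
Local Notation C := R[i].
Local Notation ix := (lshift n (ord0 : 'I_1)).
Local Notation iy := (@rshift 1 n).
Implicit Types (G : 'cV[C]_(1 + n) -> C) (c : multi_index (1 + n) -> C)
  (be : multi_index (1 + n)) (s : seq 'I_n) (k : 'I_n) (al : 'I_n -> nat).
Implicit Types (f : CP1 R -> 'cV[C]_n -> 'cV[C]_n) (p : CP1 R).

Definition in_chart p f (i : 'I_n) : 'cV[C]_(1 + n) -> C :=
  fun z => f (chart p (usubmx z 0 0)) (dsubmx z) i 0.

Lemma maclaurin_coef_slice f p i al (t : C) :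
  maclaurin_coef f i al (chart p t) =
  derive_y (enum 'I_n) al (in_chart p f i) (col_mx (const_mx t) 0)
    / (\prod_(k < n) (al k)`!)%:R.
Proof.
rewrite /maclaurin_coef -mpartial_slice; congr (mpartial _ _ _ / _).
by apply/funext => u; rewrite /in_chart col_mxKu col_mxKd mxE.
Qed.

(** Power series, in s alone, of the coefficient of y^al in the series c; it is
    written over all the variables (s, y) so that it can be multiplied by
    monomials in y. *)
Definition slice_coef al c be : C :=
  if [forall k, be (iy k) == 0%N] then
    c [ffun l => (be l + lift_y al l)%N] else 0.

(** The function depends on s only, so that its series is valid around every point
    (0, y0) and for arbitrary radii in y: its terms at w are those of the
    differentiated series of f at the point w' = (s, 0). *)
Lemma has_pseries_maclaurin f p i al c (e : C) (r : 'I_(1 + n) -> C) (y0 : 'cV[C]_n) :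
  0 < e -> r ix <= e -> has_pseries (in_chart p f i) 0 c (fun=> e) ->
  has_pseries (fun z => maclaurin_coef f i al (chart p (usubmx z 0 0)))
    (col_mx 0 y0) (slice_coef al c) r.
Proof.
move=> e0 re fc w wr.
pose w' : 'cV[C]_(1 + n) := col_mx (usubmx w) 0.
have w'x : w' ix 0 = w ix 0 by rewrite col_mxEu mxE.
have w'y k : w' (iy k) 0 = 0 by rewrite col_mxEd mxE.
have w'e : polydisc (fun=> e) w'.
  apply: index_xyP => [|k]; last by rewrite w'y normr0.
  by rewrite w'x; exact: lt_le_trans (wr ix) re.
have := has_pseries_derive_y (s := enum 'I_n) (al := al) fc w'e.
rewrite maclaurin_coef_slice add0r.
rewrite (_ : col_mx (const_mx _) 0 = w'); last first.
  congr col_mx; rewrite linearD /= col_mxKu add0r.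
  by apply/colP => j; rewrite (ord1 j) [LHS]mxE.
rewrite [_ / _]mulrC; set N := (\prod_(k < n) _)%:R.
move=> /(sums_toZ N^-1); congr sums_to; apply/funext => be.
rewrite mulrA /slice_coef; case: ifP => [/forallP be0|/negbT].
  rewrite deriv_y_coefE ?enum_uniq//; last by move=> k _; exact/eqP.
  rewrite big_enum -/N mulKf; last first.
    by rewrite pnatr_eq0 -lt0n prodn_gt0// => k; rewrite fact_gt0.
  congr (c _ * _).
    apply/ffunP => l; rewrite !ffunE; congr addn; rewrite big_enum.
    case: (split_ordP l) => [j|j] ->.
      by rewrite big1// => k _; rewrite eq_lrshift.
    rewrite (bigD1 j)//= eqxx mul1n big1 ?addn0// => k kj.
    by rewrite eq_rshift eq_sym (negPf kj).
  apply: eq_bigr => l _; move: l; apply: index_xyP => [|k]; first by rewrite w'x.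
  by rewrite (eqP (be0 k)) !expr0.
rewrite negb_forall => /existsP[k bek].
by rewrite (monomialD1 (iy k)) w'y expr0n (negPf bek) mul0r mulr0 mul0r.
Qed.

Lemma homogeneous_part_in_chart f p i j z :
  in_chart p (homogeneous_part f j) i z =
  \sum_(al : {ffun 'I_n -> 'I_j.+1} | (\sum_(k < n) (al k : nat))%N == j)
    monomial (dsubmx z) (fun k => al k) *
    maclaurin_coef f i (fun k => al k) (chart p (usubmx z 0 0)).
Proof. by rewrite /in_chart mxE; apply: eq_bigr => al _; rewrite mulrC. Qed.

Lemma has_pseries_monomial_y al G z0 c r : has_pseries G z0 c r ->
  exists d, has_pseries (fun z => monomial (dsubmx z) al * G z) z0 d r.
Proof.
move=> Gc.
have step k a d H : has_pseries H z0 d r ->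
    exists d', has_pseries (fun z => dsubmx z k 0 ^+ a * H z) z0 d' r.
  move=> Hd; elim: a => [|a [d' IH]].
    by exists d; refine (eq_has_pseries Hd _ _) => // w _; rewrite mul1r.
  have [d'' Hd''] := has_pseries_coord (iy k) IH; exists d''.
  by refine (eq_has_pseries Hd'' _ _) => // w _; rewrite exprS mulrA !mxE.
rewrite /monomial; elim: (index_enum _) => [|k s [d IH]].
  by exists c; refine (eq_has_pseries Gc _ _) => // w _; rewrite big_nil mul1r.
have [d' H] := step k (al k) _ _ IH; exists d'.
by refine (eq_has_pseries H _ _) => // w _; rewrite big_cons mulrA.
Qed.

(** Analyticity at (p, y0) for every y0: the powers of y are handled as
    coordinates that are not centered at y0. *)
Lemma has_pseries_homogeneous_part f p i j c (e : C) (r : 'I_(1 + n) -> C) (y0 : 'cV[C]_n) :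
  0 < e -> r ix <= e -> has_pseries (in_chart p f i) 0 c (fun=> e) ->
  exists d, has_pseries (in_chart p (homogeneous_part f j) i) (col_mx 0 y0) d r.
Proof.
move=> e0 re fc.
have /choice[d dP] : forall al : {ffun 'I_n -> 'I_j.+1}, exists d,
    has_pseries (fun z => monomial (dsubmx z) (fun k => al k) *
      maclaurin_coef f i (fun k => al k) (chart p (usubmx z 0 0)))
    (col_mx 0 y0) d r.
  by move=> al; apply: has_pseries_monomial_y; exact: has_pseries_maclaurin fc.
have H := has_pseries_sum (s := index_enum _)
  (P := fun al : {ffun 'I_n -> 'I_j.+1} => (\sum_(k < n) (al k : nat))%N == j) (fun a _ => dP a).
eexists; refine (eq_has_pseries H _ _) => // w _.
by rewrite homogeneous_part_in_chart.
Qed.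

Definition degree_y be : nat := (\sum_k be (iy k))%N.

Definition homogeneous_coef j c be : C := if degree_y be == j then c be else 0.

Lemma monomial_lift_y (z : 'cV[C]_(1 + n)) al :
  monomial z (lift_y al) = monomial (dsubmx z) al.
Proof.
rewrite /monomial big_split_ord /= big_ord1 lift_yx expr0 mul1r.
by apply: eq_bigr => k _; rewrite lift_yy mxE.
Qed.

(** Multiplying the slice of exponent al by y^al puts its terms back where they were
    in c; summing over al then selects a degree. *)
Lemma mono_slice_coef al c be :
  mono_coef (lift_y al) (slice_coef al c) be =
  if [forall k, be (iy k) == al k] then c be else 0.
Proof.
rewrite /mono_coef /slice_coef; case: ifP => [/forallP le|/negP le].
  rewrite (_ : [forall k, _] = [forall k, be (iy k) == al k]).
    case: ifP => // _; congr c; apply/ffunP => l; rewrite !ffunE.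
    by have := le l; rewrite ffunE => /subnK.
  apply: eq_forallb => k; rewrite ffunE lift_yy subn_eq0.
  by rewrite eqn_leq; have := le (iy k); rewrite lift_yy => ->; rewrite andbT.
case: ifP => // /forallP eq; case: le; apply/forallP; apply: index_xyP => [|k].
  by rewrite lift_yx.
by rewrite lift_yy (eqP (eq k)).
Qed.

Lemma homogeneous_coefE j c be :
  \sum_(al : {ffun 'I_n -> 'I_j.+1} | (\sum_(k < n) (al k : nat))%N == j)
    mono_coef (lift_y (fun k => al k)) (slice_coef (fun k => al k) c) be =
  homogeneous_coef j c be.
Proof.
under eq_bigr do rewrite mono_slice_coef.
rewrite /homogeneous_coef /degree_y; case: ifPn => [/eqP bej|bej].
  have bel k : (be (iy k) < j.+1)%N by rewrite ltnS -bej (bigD1 k)//= leq_addr.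
  rewrite (bigD1 [ffun k => Ordinal (bel k)])/=; last first.
    by rewrite -[X in _ == X]bej; apply/eqP/eq_bigr => k _; rewrite ffunE.
  rewrite ifT; last by apply/forallP => k; rewrite ffunE.
  rewrite big1 ?addr0// => al /andP[_ alb]; case: ifP => // /forallP eq.
  case/eqP: alb; apply/ffunP => k; apply/val_inj; rewrite ffunE /=.
  exact/esym/eqP.
rewrite big1// => al /eqP alj; case: ifP => // /forallP eq.
case/eqP: bej; rewrite -[RHS]alj; apply: eq_bigr => k _; exact/eqP.
Qed.

(** At the center (p, 0) the series is the degree j part of c.  It is valid for
    all radii in y, while the series of f itself is known on a small polydisc
    only. *)
Lemma has_pseries_homogeneous_part0 f p i j c (e : C) (r : 'I_(1 + n) -> C) :
  0 < e -> r ix <= e -> has_pseries (in_chart p f i) 0 c (fun=> e) ->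
  has_pseries (in_chart p (homogeneous_part f j) i) 0 (homogeneous_coef j c) r.
Proof.
move=> e0 re fc.
have H := has_pseries_sum (s := index_enum _)
  (P := fun al : {ffun 'I_n -> 'I_j.+1} => (\sum_(k < n) (al k : nat))%N == j)
  (fun a _ => has_pseries_mono (al := lift_y (fun k => a k))
     (has_pseries_maclaurin (al := fun k => a k) (y0 := 0) e0 re fc)).
rewrite -[X in has_pseries _ X](col_mx0 C 1 n 1).
refine (eq_has_pseries H _ _) => [w _|be].
  rewrite homogeneous_part_in_chart; apply: eq_bigr => al _.
  by rewrite monomial_lift_y col_mx0 subr0.
exact: homogeneous_coefE.
Qed.

End Homogeneous.

(** * The bracket in a chart *)

Section Bracket.
Context {R : realType} {n : nat}.
Local Notation C := R[i].
Local Notation ix := (lshift n (ord0 : 'I_1)).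
Local Notation iy := (@rshift 1 n).
Implicit Types (B : 'M[C]_n) (G : 'I_n -> 'cV[C]_(1 + n) -> C)
  (c : 'I_n -> multi_index (1 + n) -> C) (be : multi_index (1 + n)) (i k l : 'I_n).

(** The components of the bracket of a vertical field of components G with the
    linear field of matrix B, where B is a constant matrix: the value of A at
    the point under consideration. *)
Definition bracket_op B G i (z : 'cV[C]_(1 + n)) : C :=
  \sum_k B i k * G k z - 'D_(delta_mx ix 0) (G i) z -
  \sum_k \sum_l B k l * (z (iy l) 0 * 'D_(delta_mx (iy k) 0) (G i) z).

Definition unit_index l : multi_index (1 + n) := lift_y (fun k => nat_of_bool (k == l)).

Definition bracket_coef B c i be : C :=
  \sum_k B i k * c k be - deriv_coef ix (c i) be -
  \sum_k \sum_l B k l * mono_coef (unit_index l) (deriv_coef (iy k) (c i)) be.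

Lemma monomial_unit l (z : 'cV[C]_(1 + n)) : monomial z (unit_index l) = z (iy l) 0.
Proof.
rewrite monomial_lift_y /monomial (bigD1 l)//= eqxx expr1 mxE big1 ?mulr1//.
by move=> k /negPf ->; rewrite expr0.
Qed.

Lemma has_pseries_bracket B G c r i : (forall k, has_pseries (G k) 0 (c k) r) ->
  has_pseries (bracket_op B G i) 0 (bracket_coef B c i) r.
Proof.
move=> Gc.
have H1 := has_pseries_sum (s := index_enum _) (P := xpredT)
  (fun k _ => has_pseriesZ (a := B i k) (Gc k)).
have H2 := has_pseriesZ (a := -1) (has_pseries_derive (k := ix) (Gc i)).
have H3 k l := has_pseriesZ (a := B k l)
  (has_pseries_mono (al := unit_index l) (has_pseries_derive (k := iy k) (Gc i))).
have H4 k := has_pseries_sum (s := index_enum _) (P := xpredT) (fun l _ => H3 k l).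
have H5 := has_pseriesZ (a := -1)
  (has_pseries_sum (s := index_enum _) (P := xpredT) (fun k _ => H4 k)).
refine (eq_has_pseries (has_pseriesD (has_pseriesD H1 H2) H5) _ _) => [w _|be].
  rewrite !mulN1r /bracket_op; congr (_ - _); apply: eq_bigr => k _.
  by apply: eq_bigr => l _; rewrite monomial_unit subr0.
by rewrite !mulN1r.
Qed.

Lemma degree_y_incr_x be : degree_y (incr be ix 1) = degree_y be.
Proof. by apply: eq_bigr => k _; rewrite ffunE eq_rlshift addn0. Qed.

Lemma degree_y_incr_y be k : degree_y (incr be (iy k) 1) = (degree_y be).+1.
Proof.
rewrite /degree_y (bigD1 k)//= [in RHS](bigD1 k)//= ffunE eqxx addn1 addSn.
by congr (_ + _).+1; apply: eq_bigr => l /negPf lk; rewrite ffunE eq_rshift lk addn0.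
Qed.

(** Each y_l d/dy_k keeps the degree in y: be and the multi-index that
    contributes to it have the same degree. *)
Lemma bracket_coef_homogeneous B c j i be :
  bracket_coef B (fun k => homogeneous_coef j (c k)) i be =
  homogeneous_coef j (bracket_coef B c i) be.
Proof.
have mono_deg k l : mono_coef (unit_index l)
    (deriv_coef (iy k) (homogeneous_coef j (c i))) be =
  if degree_y be == j then mono_coef (unit_index l) (deriv_coef (iy k) (c i)) be else 0.
  rewrite /mono_coef; case: ifP => [/forallP le|_]; last by rewrite if_same.
  set ga := [ffun _ => _]; rewrite /deriv_coef /homogeneous_coef degree_y_incr_y.
  have <- : degree_y be = (degree_y ga).+1.
    rewrite -(degree_y_incr_y _ l); apply: eq_bigr => h _.
    have le_h := le (iy h); rewrite [RHS]ffunE [ga _]ffunE eq_rshift muln1.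
    by rewrite lift_yy in le_h *; rewrite subnK.
  by case: ifP; rewrite ?mulr0.
rewrite /bracket_coef {2}/homogeneous_coef.
under [X in _ - X = _]eq_bigr do under eq_bigr do rewrite mono_deg.
rewrite /deriv_coef /homogeneous_coef degree_y_incr_x; case: ifP => // _.
by rewrite mulr0 !big1 ?subr0// => k _; rewrite ?mulr0// big1// => l _; rewrite mulr0.
Qed.

Lemma in_chart0 (f : CP1 R -> 'cV[C]_n -> 'cV[C]_n) (x t : C) y i :
  in_chart (Some x) f i (col_mx (const_mx t) y) = f (Some (x + t)) y i 0.
Proof. by rewrite /in_chart col_mxKu col_mxKd mxE. Qed.

Lemma in_chart00 (f : CP1 R -> 'cV[C]_n -> 'cV[C]_n) (x : C) y i :
  in_chart (Some x) f i (col_mx 0 y) = f (Some x) y i 0.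
Proof. by rewrite -[in RHS](addr0 x) -in_chart0. Qed.

Lemma ddx_in_chart (f : CP1 R -> 'cV[C]_n -> 'cV[C]_n) (x : C) (y : 'cV[C]_n) i :
  ddx (fun q => f q y i 0) (Some x) =
  'D_(delta_mx ix 0) (in_chart (Some x) f i) (col_mx 0 y).
Proof.
rewrite /ddx /derive; set g := fun h => _; set g' := fun h => _.
suff -> : g = g' by [].
apply/funext => h; rewrite /g /g'; congr (_ *: (_ - _)).
  transitivity (in_chart (Some x) f i (col_mx (const_mx h) y)).
    by rewrite in_chart0 /= [h *: _ + x]addrC [h *: 1]mulr1.
  congr (in_chart _ _ _ _).
  rewrite /= -[delta_mx ix 0]vsubmxK scale_col_mx add_col_mx addr0.
  congr col_mx; apply/colP => l; rewrite !mxE.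
    by rewrite (ord1 l) !eqxx mulr1.
  by rewrite eq_rlshift mulr0 add0r.
by rewrite in_chart00.
Qed.

Lemma derive_y_in_chart (f : CP1 R -> 'cV[C]_n -> 'cV[C]_n) (x : C) (y : 'cV[C]_n) i k :
  'D_(delta_mx k 0) (fun u => f (Some x) u i 0) y =
  'D_(delta_mx (iy k) 0) (in_chart (Some x) f i) (col_mx 0 y).
Proof.
rewrite -derive_slice; congr (derive _ _ _); apply/funext => u.
by rewrite in_chart00.
Qed.

Lemma derive_linear_form (a : 'I_n -> C) (y : 'cV[C]_n) k :
  'D_(delta_mx k 0) (fun u : 'cV[C]_n => \sum_l a l * u l 0) y = a k.
Proof.
apply: (@derive_quadratic _ _ _ _ _ 1 0) => // h _.
rewrite -sumrB (bigD1 k)//= !mxE !eqxx mulr1 mulrDr big1 => [|l /negPf lk].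
  by rewrite mul0r (_ : _ - _ = 0) ?normr0//; ring.
by rewrite !mxE lk mulr0 addr0 subrr.
Qed.

Lemma lie_bracket_in_chart (f : CP1 R -> 'cV[C]_n -> 'cV[C]_n)
    (A : 'M[CP1 R -> C]_n) (x : C) (y : 'cV[C]_n) :
  lie_bracket (vertical f) (linear_vfield A) (Some x) y =
  (0, \col_i bracket_op (\matrix_(k, l) A k l (Some x)) (in_chart (Some x) f) i
        (col_mx 0 y)).
Proof.
have vE phi : apply_vfield (vertical f) phi (Some x) y =
    \sum_k f (Some x) y k 0 * 'D_(delta_mx k 0) (phi (Some x)) y.
  by rewrite /apply_vfield mul0r add0r.
have XE phi : apply_vfield (linear_vfield A) phi (Some x) y =
    ddx (phi^~ y) (Some x) + \sum_k (\sum_l A k l (Some x) * y l 0) *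
      'D_(delta_mx k 0) (phi (Some x)) y.
  rewrite /apply_vfield mul1r; congr (_ + _).
  by apply: eq_bigr => k _; rewrite [X in X * _]mxE.
have D0 (a : C) k : 'D_(delta_mx k 0) (fun _ : 'cV[C]_n => a) y = 0.
  exact: derive_cst.
have DA (i k : 'I_n) :
    'D_(delta_mx k 0) (fun u => (linear_vfield A (Some x) u).2 i 0) y = A i k (Some x).
  rewrite -(derive_linear_form (fun l => A i l (Some x)) y k).
  by congr (derive _ _ _); apply/funext => u; rewrite [LHS]mxE.
rewrite /lie_bracket; congr (_, _).
  rewrite vE XE [X in X - _](_ : _ = 0); last first.
    by apply: big1 => k _; rewrite [X in _ * X](D0 1 k) mulr0.
  rewrite [X in _ - X](_ : _ = 0) ?subrr// [X in X + _](_ : _ = 0).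
    by rewrite add0r; apply: big1 => k _; rewrite [X in _ * X](D0 0 k) mulr0.
  exact: derive_cst.
apply/colP => i; rewrite [LHS]mxE [RHS]mxE vE XE /bracket_op opprD addrA.
rewrite ddx_in_chart; congr (_ + - _); first congr (_ + _).
  apply: eq_bigr => k _.
  by rewrite [X in _ = X * _]mxE in_chart00 mulrC [X in X * _](DA i k).
apply: eq_bigr => k _; rewrite mulr_suml; apply: eq_bigr => l _.
rewrite [X in _ = X * _]mxE col_mxEd -mulrA; congr (_ * (_ * _)).
exact: derive_y_in_chart.
Qed.

End Bracket.

(** * Restriction to a fiber *)

Section Vanishing.
Context {R : realType} {n : nat}.
Local Notation C := R[i].
Local Notation ix := (lshift n (ord0 : 'I_1)).
Local Notation iy := (@rshift 1 n).

(** The order of the complex numbers is not total, which excludes taking a minimum;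
    the inverse of 1 plus the sum of the inverses is a lower bound. *)
Lemma common_radius (I : finType) (e : I -> C) : (forall i, 0 < e i) ->
  exists2 e0, 0 < e0 & forall i, e0 <= e i.
Proof.
move=> e_gt0; have s0 (P : pred I) : 0 <= \sum_(i | P i) (e i)^-1.
  by apply: sumr_ge0 => i _; rewrite invr_ge0 ltW.
have s1 : 0 < 1 + \sum_i (e i)^-1 by rewrite ltr_pwDl.
exists (1 + \sum_i (e i)^-1)^-1 => [|i]; first by rewrite invr_gt0.
rewrite -[leRHS]invrK lef_pV2 ?posrE ?invr_gt0// (bigD1 i)//= addrCA.
by rewrite lerDl addr_ge0.
Qed.

(** The terms free of s form a power series in all the variables, whose sum is f
    composed with the projection (s, y) -> (0, y), that is, zero. *)
Lemma coef_eq0_of_eq0_on_fiber (f : 'cV[C]_(1 + n) -> C) c (r : 'I_(1 + n) -> C) :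
  (forall l, 0 < r l) -> has_pseries f 0 c r -> (forall y, f (col_mx 0 y) = 0) ->
  forall be : multi_index (1 + n), be ix = 0%N -> c be = 0.
Proof.
move=> r0 fc f0 be bex.
pose d (ga : multi_index (1 + n)) := if ga ix == 0%N then c ga else 0.
have fd : has_pseries (fun z => f (col_mx 0 (dsubmx z))) 0 d r.
  move=> w wr; pose w' : 'cV[C]_(1 + n) := col_mx 0 (dsubmx w).
  have w'x : w' ix 0 = 0 by rewrite col_mxEu mxE.
  have w'y k : w' (iy k) 0 = w (iy k) 0 by rewrite col_mxEd mxE.
  have /fc : polydisc r w'.
    by apply: index_xyP => [|k]; rewrite ?w'x ?normr0 ?w'y//; exact: wr.
  rewrite !add0r; congr sums_to; apply/funext => ga.
  rewrite /d; case: eqP => [gax|/eqP gax].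
    congr (_ * _); apply: eq_bigr => l _; move: l.
    by apply: index_xyP => [|k]; rewrite ?gax ?expr0 ?w'y.
  by rewrite (monomialD1 ix) w'x expr0n (negPf gax) !mul0r mulr0.
have := has_pseries_eq0 r0 fd (fun w _ => f0 _) be.
by rewrite /d bex eqxx.
Qed.

Lemma eq0_on_fiber_of_coef_eq0 (f : 'cV[C]_(1 + n) -> C) c (r : 'I_(1 + n) -> C) y :
  has_pseries f 0 c r -> polydisc r (col_mx 0 y) ->
  (forall be : multi_index (1 + n), be ix = 0%N -> c be = 0) -> f (col_mx 0 y) = 0.
Proof.
move=> fc yr c0; have := fc _ yr; rewrite add0r => fy; apply: sums_to_unique fy _.
rewrite (_ : (fun al => _) = fun=> 0); first exact: sums_to0.
apply/funext => be; have [/c0 ->|bex] := eqVneq (be ix) 0%N; first by rewrite mul0r.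
by rewrite (monomialD1 ix) col_mxEu mxE expr0n (negPf bex) mul0r mulr0.
Qed.

End Vanishing.

(** * Homogeneous components of a symmetry *)

Theorem lemma3p3 (R : realType) (n : nat) (n_ge1 : (1 <= n)%N)
  (U : set (CP1 R)) (U_neq0 : U !=set0) (U_open : open U)
  (U_conn : connected U)
  (K : set (CP1 R -> R[i])) (K_ff : function_field U K)
  (A : 'M[CP1 R -> R[i]]_n) (A_K : forall i j, K (A i j))
  (V : set (CP1 R)) (V_open : open V) (VU : V `<=` U)
  (Y : CP1 R -> 'cV[R[i]]_n -> 'cV[R[i]]_n) (Y_sym : sym A V Y) :
  forall j : nat, sym A V (homogeneous_part Y j).
Proof.
move=> j.
have Y_series p i : V p -> exists c, exists2 e : R[i], 0 < e &
    has_pseries (in_chart p Y i) 0 c (fun=> e).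
  move=> Vp; have [c cP] := sym_analytic Y_sym 0 i Vp; exists c.
  by rewrite -(col_mx0 _ 1 n 1); exact: near_has_pseries cP.
split=> [p y i Vp|x y Vx Ax].
  have [c [e e0 Yc]] := Y_series p i Vp.
  have [d dP] :=
    has_pseries_homogeneous_part (r := fun=> e) j y e0 (lexx _) Yc.
  by exists d; apply: has_pseries_near dP => _; exact: e0.
rewrite lie_bracket_in_chart; congr (_, _); apply/colP => i; rewrite [LHS]mxE [RHS]mxE.
set B := \matrix_(_, _) _.
have /choice[c /choice[e ceP]] : forall k, exists c, exists e : R[i], 0 < e /\
    has_pseries (in_chart (Some x) Y k) 0 c (fun=> e).
  by move=> k; have [c [e e0 Yc]] := Y_series _ k Vx; exists c, e.
have [e0 e0_gt0 e0_le] := common_radius (fun k => (ceP k).1).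
have Yc k : has_pseries (in_chart (Some x) Y k) 0 (c k) (fun=> e0).
  exact: has_pseries_sub (fun=> e0_le k) (ceP k).2.
have coef0 : forall be : multi_index (1 + n),
    be (lshift n ord0) = 0%N -> bracket_coef B c i be = 0.
  refine (coef_eq0_of_eq0_on_fiber (fun=> e0_gt0)
    (has_pseries_bracket (B := B) (i := i) Yc) _) => u.
  have := sym_bracket Y_sym u Vx Ax; rewrite lie_bracket_in_chart.
  by move=> [] /colP/(_ i); rewrite [LHS]mxE [RHS]mxE.
(* The polydisc is narrow in s but contains the given, arbitrarily large, y. *)
pose r (l : 'I_(1 + n)) : R[i] := `|col_mx (0 : 'cV_1) y l 0| + e0.
have Fc k : has_pseries (in_chart (Some x) (homogeneous_part Y j) k) 0
    (homogeneous_coef j (c k)) r.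
  apply: has_pseries_homogeneous_part0 (Yc k) => //.
  by rewrite /r col_mxEu mxE normr0 add0r.
refine (eq0_on_fiber_of_coef_eq0
  (has_pseries_bracket (B := B) (i := i) Fc) _ _) => [l|be be0].
  by rewrite /r ltrDl.
by rewrite bracket_coef_homogeneous /homogeneous_coef coef0 ?if_same.
Qed.
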